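(* Let $w\in\mathcal{A}^*$ be a non-empty finite word whose fractionary root $z_w$ is a $c$-epichristoffel word. Then $w$ is a factor of some episturmian sequence.
   Context: $\mathcal{A}$ is a finite alphabet. For $w=w[0]\cdots w[n-1]$, an integer $p\geq 1$ is a period of $w$ if $w[i]=w[i+p]$ for all $0\le i<n-p$; the fractionary root $z_w$ of $w$ is the prefix of $w$ whose length is the smallest period $p\ge 1$ of $w$. For a finite word $u$, $u^{(+)}$ denotes the shortest palindrome having $u$ as prefix. An infinite word $s$ is standard episturmian if for every prefix $u$ of $s$, $u^{(+)}$ is a prefix of $s$; an infinite word is episturmian if it has the same set of factors as some standard episturmian sequence. For $a,b\in\mathcal{A}$: $\psi_a(a)=\overline{\psi}_a(a)=a$, $\psi_a(x)=ax$, $\overline{\psi}_a(x)=xa$ for letters $x\neq a$, and $\theta_{ab}$ swaps $a,b$ and fixes other letters. Episturmian morphisms are the compositions of these morphisms. A finite word is $c$-epichristoffel if it is the image of a letter under an episturmian morphism. *)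

(* Defs.v *)
From mathcomp Require Import all_boot all_fingroup.

Set Implicit Arguments.
Unset Strict Implicit.
Unset Printing Implicit Defensive.

Section Words.

Variable A : finType.

(* [onth] returns [None] out of range, but [i + p < size w] for the indices
   considered here, so only genuine letters are compared. *)
Definition is_period (w : seq A) (p : nat) : bool :=
  (0 < p) && [forall i : 'I_(size w - p), onth w i == onth w (i + p)].

Lemma ex_period (w : seq A) : exists p, is_period w p.
Proof.
exists (size w).+1; apply/andP; split => //; apply/forallP => -[i].
by rewrite subnS subnn.
Qed.

Definition min_period (w : seq A) : nat := ex_minn (ex_period w).

Definition fractionary_root (w : seq A) : seq A := take (min_period w) w.

Definition palindrome (v : seq A) : Prop := rev v = v.

(* [pal_closure u v] is the relation v = u^(+); it is functional and total, see
   [pal_closure_uniq] and [ex_pal_closure]. *)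
Definition pal_closure (u v : seq A) : Prop :=
  [/\ palindrome v, prefix u v
    & forall v' : seq A, palindrome v' -> prefix u v' -> size v <= size v'].

Lemma ex_pal_closure (u : seq A) : exists v, pal_closure u v.
Proof.
pose P n := [exists t : n.-tuple A, (rev t == t) && prefix u t].
have exP : exists n, P n.
  exists (size (u ++ rev u)); apply/existsP; exists (in_tuple (u ++ rev u)) => /=.
  by rewrite rev_cat revK eqxx prefix_prefix.
case: (ex_minnP exP) => n /existsP [t /andP [/eqP tpal ut]] minn.
exists t; split => // v' v'pal uv'; rewrite size_tuple; apply: minn.
by apply/existsP; exists (in_tuple v'); rewrite /= v'pal eqxx.
Qed.

Lemma pal_closure_uniq (u v1 v2 : seq A) :
  pal_closure u v1 -> pal_closure u v2 -> v1 = v2.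
Proof.
case=> pal1 pre1 min1 [pal2 pre2 min2].
have eqsz : size v1 = size v2.
  by apply/eqP; rewrite eqn_leq min1 ?min2.
have le_2u : size v1 <= (size u).*2.
  rewrite -addnn -{2}(size_rev u) -size_cat; apply: min1 (prefix_prefix _ _).
  by rewrite /palindrome rev_cat revK.
case/prefixP: pre1 pal1 eqsz le_2u => s1 ->; case/prefixP: pre2 pal2 => s2 ->.
rewrite /palindrome !rev_cat !size_cat -addnn => pal2 pal1.
move=> /eqP; rewrite eqn_add2l => /eqP eqs; rewrite leq_add2l => le_s1u.
congr (_ ++ _); apply: (can_inj revK).
have /(congr1 (take (size s1))) := pal1.
have /(congr1 (take (size s1))) := pal2.
rewrite !take_cat !size_rev eqs ltnn subnn take0 cats0.
have -> : (if size s2 < size u then take (size s2) u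
          else u ++ take (size s2 - size u) s2) = take (size s2) u.
  rewrite -eqs in le_s1u *; case: ltnP => // le_u.
  have -> : size s1 = size u by apply/eqP; rewrite eqn_leq le_s1u le_u.
  by rewrite subnn take0 cats0 take_size.
have -> : (if size s2 < size u then take (size s2) u
          else u ++ take (size s2 - size u) s1) = take (size s2) u.
  rewrite -eqs in le_s1u *; case: ltnP => // le_u.
  have -> : size s1 = size u by apply/eqP; rewrite eqn_leq le_s1u le_u.
  by rewrite subnn take0 cats0 take_size.
by rewrite !cats0 => -> ->.
Qed.

Definition prefix_inf (u : seq A) (s : nat -> A) : Prop :=
  u = mkseq s (size u).

Definition factor_inf (u : seq A) (s : nat -> A) : Prop :=
  exists i : nat, u = mkseq (fun k => s (i + k)) (size u).

Definition standard_episturmian (s : nat -> A) : Prop :=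
  forall u v : seq A, prefix_inf u s -> pal_closure u v -> prefix_inf v s.

Definition episturmian (t : nat -> A) : Prop :=
  exists s : nat -> A,
    standard_episturmian s /\ forall u : seq A, factor_inf u t <-> factor_inf u s.

Definition word_morphism (f : A -> seq A) (w : seq A) : seq A :=
  flatten (map f w).

Definition psi (a x : A) : seq A := if x == a then [:: a] else [:: a; x].

Definition psibar (a x : A) : seq A := if x == a then [:: a] else [:: x; a].

Definition theta (a b x : A) : seq A := [:: tperm a b x].

(* The identity morphism is included, as [theta a a]. *)
Inductive episturmian_morphism : (seq A -> seq A) -> Prop :=
| Episturmian_psi a : episturmian_morphism (word_morphism (psi a))
| Episturmian_psibar a : episturmian_morphism (word_morphism (psibar a))
| Episturmian_theta a b : episturmian_morphism (word_morphism (theta a b))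
| Episturmian_comp f g :
    episturmian_morphism f -> episturmian_morphism g ->
    episturmian_morphism (f \o g).

Definition c_epichristoffel (u : seq A) : Prop :=
  exists (f : seq A -> seq A) (a : A), episturmian_morphism f /\ u = f [:: a].

End Words.

(* Main.v *)
Require Import Defs.
From mathcomp Require Import all_boot all_fingroup.

(** Every episturmian morphism [f] sends the factors of a standard episturmian
    word into the factors of another one.  For [psi a] this is because
    [psi a (-) ++ [:: a]] matches the palindromes of [s] with the palindromes
    of [psi a s] that begin with [a], hence also longest palindromic suffixes
    and palindromic closures; [psibar a] is conjugate to [psi a].  Starting from
    the constant word, all powers of [f [:: a]] are factors of one standard
    episturmian word, and a word is a prefix of a power of its fractionary
    root. *)

Section InfiniteWords.

Set Implicit Arguments.
Unset Strict Implicit.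
Unset Printing Implicit Defensive.

Variable A : finType.
Implicit Types (s : nat -> A) (u v w x y z : seq A) (a : A).

(** * Prefixes and factors of infinite words *)

Lemma mkseqD s i n : mkseq s (i + n) = mkseq s i ++ mkseq (fun k => s (i + k)) n.
Proof. by rewrite /mkseq iotaD map_cat addnC iotaDl -map_comp. Qed.

Lemma prefix_infP s u : prefix_inf u s <-> exists k, prefix u (mkseq s k).
Proof.
split=> [-> | [k]]; first by exists (size u); exact: prefix_refl.
case/prefixP=> t def_t; rewrite /prefix_inf.
have le_uk : size u <= k by rewrite -(size_mkseq s k) def_t size_cat leq_addr.
move: def_t; rewrite -(subnKC le_uk) mkseqD => /eqP.
by rewrite eqseq_cat ?size_mkseq // => /andP [/eqP].
Qed.

Lemma factor_infP s u : factor_inf u s <-> exists k, infix u (mkseq s k).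
Proof.
split=> [[i ->] | [k]].
  by exists (i + size u); rewrite mkseqD infix_catl ?infix_refl.
case/infixP=> t [t' def_t]; exists (size t).
have le_k : size t + size u <= k.
  by rewrite -(size_mkseq s k) def_t !size_cat addnA leq_addr.
move: def_t; rewrite -(subnKC le_k) mkseqD mkseqD catA => /eqP.
rewrite eqseq_cat ?size_cat ?size_mkseq //.
by rewrite eqseq_cat ?size_mkseq // => /andP [/andP [_ /eqP ->] _].
Qed.

Lemma factor_inf_infix s u v : infix u v -> factor_inf v s -> factor_inf u s.
Proof.
move=> uv /factor_infP [k vk]; apply/factor_infP; exists k.
exact: infix_trans uv vk.
Qed.

Lemma prefix_inf_prefix s u v : prefix u v -> prefix_inf v s -> prefix_inf u s.
Proof.
move=> uv /prefix_infP [k vk]; apply/prefix_infP; exists k.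
exact: prefix_trans uv vk.
Qed.

Lemma prefix_inf_mkseq s n : prefix_inf (mkseq s n) s.
Proof. by rewrite /prefix_inf size_mkseq. Qed.

(** * Palindromic closure through the longest palindromic suffix *)

Definition longest_pal_suffix z y :=
  palindrome y /\
  forall z' y', z' ++ y' = z ++ y -> palindrome y' -> size z <= size z'.

Lemma ex_longest_pal_suffix u :
  exists z y, u = z ++ y /\ longest_pal_suffix z y.
Proof.
have exP : exists n, rev (drop n u) == drop n u.
  by exists (size u); rewrite drop_size.
case: (ex_minnP exP) => n /eqP pal_n min_n.
exists (take n u), (drop n u); rewrite cat_take_drop; split => //; split => //.
move=> z' y'; rewrite cat_take_drop => def_u pal_y'.
apply: (@leq_trans n); first by rewrite size_take_min geq_minl.
by apply: min_n; rewrite -def_u drop_size_cat //; apply/eqP.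
Qed.

(** Let a palindrome extend [z ++ y] by [r]. If [r] is shorter than [z ++ y], the palindrome begins
    with [rev r], and what lies between [rev r] and [r] is a palindromic suffix of [z ++ y].
    Maximality of [y] then makes [r] at least as long as [z]. *)
Lemma longest_pal_suffix_closure z y :
  longest_pal_suffix z y -> pal_closure (z ++ y) (z ++ y ++ rev z).
Proof.
case=> pal_y max_y; split.
- by rewrite /palindrome !rev_cat revK pal_y catA.
- by rewrite catA prefix_prefix.
move=> v pal_v /prefixP [r def_v].
rewrite def_v catA (size_cat _ r) (size_cat _ (rev z)) size_rev leq_add2l.
have [le_ur | /ltnW le_ru] := leqP (size (z ++ y)) (size r).
  by apply: leq_trans le_ur; rewrite size_cat leq_addr.
have def_u : take (size r) (z ++ y) = rev r.
  have := congr1 (take (size r)) pal_v.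
  by rewrite def_v rev_cat take_size_cat ?size_rev // [take _ (_ ++ r)]takel_cat.
have := max_y (rev r) (drop (size r) (z ++ y)).
rewrite -{1}def_u cat_take_drop size_rev; apply => //.
move: pal_v; rewrite /palindrome def_v -{1 2}(cat_take_drop (size r) (z ++ y)).
rewrite def_u !rev_cat revK -catA => /eqP.
by rewrite eqseq_cat // eqseq_cat ?size_rev // => /and3P [_ /eqP ->].
Qed.

(** Replaces the minimality in [pal_closure] by an explicit word, which can be transported through
    morphisms. *)
Lemma standard_episturmianP s :
  standard_episturmian s <->
  forall z y, longest_pal_suffix z y -> prefix_inf (z ++ y) s ->
              prefix_inf (z ++ y ++ rev z) s.
Proof.
split=> [std_s z y lps_zy pre_zy | std_s u v pre_u clo_v].
  exact: std_s pre_zy (longest_pal_suffix_closure lps_zy).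
have [z [y [def_u lps_zy]]] := ex_longest_pal_suffix u.
rewrite def_u in pre_u clo_v.
rewrite (pal_closure_uniq clo_v (longest_pal_suffix_closure lps_zy)).
exact: std_s.
Qed.

Lemma standard_episturmian_const a : standard_episturmian (fun=> a).
Proof.
have constP u : prefix_inf u (fun=> a) <-> all (pred1 a) u.
  rewrite /prefix_inf; split=> [-> | ].
    by rewrite all_map; apply/allP => i _ /=.
  by elim: u => //= c u IHu /andP [/eqP -> /IHu {1}->]; rewrite (mkseqD _ 1).
apply/standard_episturmianP => z y _ /constP; rewrite all_cat => /andP [az ay].
by apply/constP; rewrite !all_cat all_rev az ay.
Qed.

(** Renaming letters preserves palindromes; as [h] is its own inverse, factorisations pull back
    along it, so longest palindromic suffixes are preserved too. *)
Lemma standard_episturmian_map (h : A -> A) s :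
  involutive h -> standard_episturmian s -> standard_episturmian (h \o s).
Proof.
move=> hK /standard_episturmianP std_s.
have mapK : involutive (map h) by exact: mapK.
have pal_map u : palindrome u -> palindrome (map h u).
  by rewrite /palindrome -map_rev => ->.
have pre_map s' u : prefix_inf u s' -> prefix_inf (map h u) (h \o s').
  by rewrite /prefix_inf size_map => {1}->; rewrite -map_comp.
have pre_mapV u : prefix_inf u (h \o s) -> prefix_inf (map h u) s.
  by rewrite /prefix_inf size_map => {1}->; rewrite -map_comp; apply: eq_map => k /=.
apply/standard_episturmianP => z y [pal_y max_y] /pre_mapV; rewrite map_cat => pre_zy.
rewrite -(mapK (_ ++ _)); apply: pre_map; rewrite !map_cat map_rev.
apply: std_s pre_zy; split; first exact: pal_map.
move=> z' y' /(congr1 (map h)); rewrite -map_cat mapK map_cat => def_zy pal_y'.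
by rewrite size_map -(size_map h z'); apply: max_y def_zy _; apply: pal_map.
Qed.

End InfiniteWords.

(** * The morphisms [psi a] and [psibar a] on finite words *)

Section Psi.

Set Implicit Arguments.
Unset Strict Implicit.
Unset Printing Implicit Defensive.

Variables (A : finType) (a : A).
Implicit Types (s : nat -> A) (u v w x y z : seq A) (b c : A).

Local Notation Psi := (word_morphism (psi a)).
Local Notation Psibar := (word_morphism (psibar a)).

Lemma word_morphism_cat (f : A -> seq A) u v :
  word_morphism f (u ++ v) = word_morphism f u ++ word_morphism f v.
Proof. by rewrite /word_morphism map_cat flatten_cat. Qed.

Lemma psi_psibar c : psi a c ++ [:: a] = a :: psibar a c.
Proof. by rewrite /psi /psibar; case: ifP. Qed.

Lemma Psi_Psibar x : Psi x ++ [:: a] = a :: Psibar x.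
Proof.
elim: x => //= c x IHx.
rewrite /word_morphism /= -/(Psi x) -/(Psibar x).
by rewrite -catA IHx -cat_rcons -cats1 psi_psibar.
Qed.

Lemma rev_Psi x : rev (Psi x) = Psibar (rev x).
Proof.
elim/last_ind: x => //= x c IHx.
rewrite -cats1 word_morphism_cat !rev_cat IHx word_morphism_cat; congr (_ ++ _).
by rewrite /word_morphism /= !cats0 /psi /psibar; case: ifP.
Qed.

(** Reversal turns [Psi] into [Psibar], and the extra [a] absorbs the conjugation between them. *)
Lemma rev_Psi_letter x : rev (Psi x ++ [:: a]) = Psi (rev x) ++ [:: a].
Proof. by rewrite rev_cat rev_Psi Psi_Psibar. Qed.

Lemma size_Psi x : size x <= size (Psi x).
Proof.
elim: x => //= c x IHx; rewrite /word_morphism /= size_cat -/(Psi x) -add1n.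
by rewrite leq_add // /psi; case: ifP.
Qed.

(** The image of a letter starts with [a] and has no other [a], so a cut just before an [a] never
    falls inside the image of a letter. *)
Lemma Psi_letter_splitl x u v :
  Psi x ++ [:: a] = u ++ a :: v ->
  exists z y, [/\ x = z ++ y, u = Psi z & a :: v = Psi y ++ [:: a]].
Proof.
elim: x u => [|c x IHx] u.
  by case: u => [[<-] | c [|//]]; exists [::], [::].
case: u => [|d u] def_u.
  by exists [::], (c :: x).
move: def_u; rewrite /word_morphism /= -/(Psi x) /psi.
case: eqVneq => [-> | c_neq] /= [<-].
  case/IHx=> z [y [-> -> ->]]; exists (a :: z), y.
  by rewrite /word_morphism /= /psi eqxx.
case: u => [[/eqP/negPn] | e u [<-]]; first by rewrite c_neq.
case/IHx=> z [y [-> -> ->]]; exists (c :: z), y.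
by rewrite /word_morphism /= /psi (negPf c_neq).
Qed.

Lemma Psi_inj : injective Psi.
Proof.
elim=> [|c x IHx] [|d y]; rewrite /word_morphism //= -?/(Psi _) /psi.
- by case: ifP.
- by case: ifP.
(* A non-empty image starts with [a], so after a leading [a] a letter other than [a] can only
   complete a two-letter block. *)
have Psi_cons z e t : Psi z = e :: t -> e = a.
  by case: z => //= f z; rewrite /word_morphism /= /psi; case: ifP => _ [].
case: eqVneq => [-> | c_neq]; case: eqVneq => [-> | d_neq] /=.
- by case=> /IHx ->.
- by case=> /Psi_cons d_eq; rewrite d_eq eqxx in d_neq.
- by case=> /esym /Psi_cons c_eq; rewrite c_eq eqxx in c_neq.
by case=> -> /IHx ->.
Qed.

Lemma palindrome_Psi_letter x : palindrome (Psi x ++ [:: a]) <-> palindrome x.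
Proof.
rewrite /palindrome rev_Psi_letter; split=> [|-> //].
by rewrite !cats1 => /eqP; rewrite eqseq_rcons => /andP [/eqP /Psi_inj].
Qed.

(* The default letter is never used: [psi a] does not shorten words. *)
Definition psi_inf s : nat -> A := fun n => nth a (Psi (mkseq s n.+1)) n.

(** * Prefixes of the image of an infinite word *)

Lemma prefix_Psi u v : prefix u v -> prefix (Psi u) (Psi v).
Proof. by case/prefixP=> t ->; rewrite word_morphism_cat prefix_prefix. Qed.

Lemma prefix_mkseq s m n : m <= n -> prefix (mkseq s m) (mkseq s n).
Proof. by move/subnKC <-; rewrite mkseqD prefix_prefix. Qed.

Lemma prefix_nth (T : eqType) (x0 : T) (u v : seq T) i :
  prefix u v -> i < size u -> nth x0 v i = nth x0 u i.
Proof. by case/prefixP=> t -> lt_iu; rewrite nth_cat lt_iu. Qed.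

Lemma prefix_inf_Psi s k : prefix_inf (Psi (mkseq s k)) (psi_inf s).
Proof.
apply: (@eq_from_nth _ a) => [|i lt_i]; rewrite ?size_mkseq // nth_mkseq //.
rewrite /psi_inf; have lt_ii : i < size (Psi (mkseq s i.+1)).
  by apply: leq_trans (size_Psi _); rewrite size_mkseq.
case: (leqP k i.+1) => [le_k | /ltnW le_k].
  by rewrite (prefix_nth _ (prefix_Psi (prefix_mkseq s le_k))).
by rewrite -(prefix_nth _ (prefix_Psi (prefix_mkseq s le_k))).
Qed.

Lemma prefix_inf_Psi_letter s x :
  prefix_inf x s -> prefix_inf (Psi x ++ [:: a]) (psi_inf s).
Proof.
move=> ->; apply: prefix_inf_prefix (prefix_inf_Psi s (size x).+1).
(* The final [a] is the first letter of the image of the letter that follows [x] in [s]. *)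
rewrite -addn1 mkseqD word_morphism_cat prefix_catr // eqxx.
by rewrite /word_morphism /= /psi; case: ifP; rewrite /= eqxx.
Qed.

Lemma prefix_inf_psi_inf s u :
  prefix_inf u (psi_inf s) -> exists2 x, prefix_inf x s & prefix u (Psi x).
Proof.
move=> ->; exists (mkseq s (size u)); first exact: prefix_inf_mkseq.
have le_u : size u <= size (Psi (mkseq s (size u))).
  by apply: leq_trans (size_Psi _); rewrite size_mkseq.
have := prefix_inf_Psi s (size u); rewrite /prefix_inf => ->.
exact: prefix_mkseq.
Qed.

Lemma psi_inf_letter s z :
  prefix_inf (z ++ [:: a]) (psi_inf s) ->
  exists2 x, prefix_inf x s & z = Psi x.
Proof.
case/prefix_inf_psi_inf=> x pre_x /prefixP [t def_x].
have /Psi_letter_splitl [x1 [x2 [def_x12 def_z _]]] :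
  Psi x ++ [:: a] = z ++ a :: t ++ [:: a] by rewrite def_x -!catA.
exists x1 => //; apply: prefix_inf_prefix pre_x.
by rewrite def_x12 prefix_prefix.
Qed.

(** A letter [b] other than [a] occurs only as the end of a block [[:: a; b]]; what follows it is
    the next block or the appended letter, hence an [a]. *)
Lemma prefix_Psi_last x u b :
  b != a -> prefix (rcons u b) (Psi x) ->
  exists v, u = rcons v a /\ prefix (rcons (rcons u b) a) (Psi x ++ [:: a]).
Proof.
move=> b_neq; elim: x u => [|c x IHx] u; first by case: u.
rewrite /word_morphism /= -/(Psi x) /psi; case: eqVneq => [_ | _].
  case: u => [|d u] /=; first by rewrite (negPf b_neq).
  case/andP=> /eqP -> /IHx [v [-> ?]]; exists (a :: v); split => //=.
  by rewrite eqxx.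
case: u => [|d [|e u]] /=; first by rewrite (negPf b_neq).
  case/and3P=> /eqP -> /eqP -> _; exists [::]; rewrite !eqxx; split => //.
  by rewrite Psi_Psibar prefix_cons eqxx prefix0s.
case/and3P=> /eqP -> /eqP -> /IHx [v [-> ?]]; exists (a :: c :: v).
by rewrite /= !eqxx.
Qed.

(** * Palindromic closures in the image word *)

Lemma psi_inf_longest_pal_suffix s z y :
  standard_episturmian s ->
  longest_pal_suffix z (a :: y) ->
  (exists2 x, prefix_inf x s & z ++ a :: y = Psi x ++ [:: a]) ->
  prefix_inf (z ++ (a :: y) ++ rev z) (psi_inf s).
Proof.
move=> /standard_episturmianP std_s [pal_y max_y] [x pre_x def_x].
(* The factorisation is pulled back to [x = x1 ++ x2]. There [x2] is again the longest palindromic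
   suffix, so [s] begins with [x1 ++ x2 ++ rev x1], whose image is the required prefix. *)
have [x1 [x2 [def_x12 def_z def_y]]] := Psi_letter_splitl (esym def_x).
rewrite def_x12 in pre_x; rewrite def_y in pal_y max_y *.
have -> : z ++ (Psi x2 ++ [:: a]) ++ rev z = Psi (x1 ++ x2 ++ rev x1) ++ [:: a].
  by rewrite !word_morphism_cat def_z rev_Psi -!catA Psi_Psibar.
apply: prefix_inf_Psi_letter; apply: std_s pre_x; split.
  exact/palindrome_Psi_letter.
move=> z' y' def_zy pal_y'.
have /max_y : Psi z' ++ (Psi y' ++ [:: a]) = z ++ (Psi x2 ++ [:: a]).
  by rewrite def_z !catA -!word_morphism_cat def_zy.
move/(_ (proj2 (palindrome_Psi_letter y') pal_y')); rewrite def_z.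
(* Lengths of images are compared with lengths of words: if [z'] were a proper prefix of [x1], its
   image would be strictly shorter than that of [x1]. *)
move: def_zy => /(congr1 (take (size z'))) def_z' le_zz'.
have [//|lt_z'z] := leqP (size x1) (size z').
move: def_z'; rewrite take_size_cat // takel_cat ?(ltnW lt_z'z) // => def_z'.
move: le_zz'; rewrite -(cat_take_drop (size z') x1) -def_z' word_morphism_cat.
rewrite size_cat -{2}(addn0 (size _)) leq_add2l => le0.
have := leq_trans (size_Psi _) le0.
by rewrite size_drop leqn0 subn_eq0 leqNgt lt_z'z.
Qed.

Lemma palindrome_cons_rcons c y d :
  palindrome (c :: rcons y d) -> c = d /\ palindrome y.
Proof.
rewrite /palindrome rev_cons rev_rcons /= => -[-> /eqP].
by rewrite eqseq_rcons => /andP [/eqP].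
Qed.

Lemma longest_pal_suffix_wrap z y c :
  longest_pal_suffix (rcons z c) y -> longest_pal_suffix z (c :: rcons y c).
Proof.
case=> pal_y max_y; split; first by rewrite /palindrome rev_cons rev_rcons pal_y.
move=> z' [|d y'].
  by rewrite cats0 => ->; rewrite size_cat leq_addr.
case/lastP: y' => [|y' e].
  rewrite !cats1 -cat_rcons -rcons_cat => /rcons_inj [-> _] _.
  by rewrite size_cat size_rcons addSnnS leq_addr.
rewrite -!cat_rcons -!rcons_cat => /rcons_inj [def_u _].
case/palindrome_cons_rcons=> _ /(max_y _ _ def_u).
by rewrite !size_rcons.
Qed.

(** Words whose longest palindromic suffix starts with [a] are pulled back to [s]; the others are
    reduced to these. *)
Lemma standard_episturmian_psi s :
  standard_episturmian s -> standard_episturmian (psi_inf s).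
Proof.
move=> std_s; apply/standard_episturmianP => z y lps_zy pre_zy.
case: y => [|c y] in lps_zy pre_zy *.
  (* A single letter is a palindrome, so the longest palindromic suffix is empty only for the empty
     word. *)
  case/lastP: z => [|z c] in lps_zy pre_zy *; first exact: pre_zy.
  have [_ /(_ z [:: c])] := lps_zy.
  by rewrite cats1 cats0 size_rcons ltnn => /(_ erefl erefl).
have [y' def_y] : exists y', c :: y = rcons y' c.
  case: lps_zy => + _; case/lastP: y {pre_zy} => [|y d]; first by exists [::].
  by case/palindrome_cons_rcons=> <- _; exists (c :: y).
(* If [c != a], each occurrence of [c] in [psi a s] is surrounded by two [a]'s,
   so that the longest palindromic suffix extends by [a] on both sides. *)
case: (eqVneq c a) => [c_eq | c_neq].
  rewrite c_eq in def_y lps_zy pre_zy *.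
  apply: psi_inf_longest_pal_suffix => //.
  rewrite def_y -rcons_cat -cats1 in pre_zy *.
  by case/psi_inf_letter: pre_zy => x pre_x ->; exists x.
have [x pre_x pre_zyx] := prefix_inf_psi_inf pre_zy.
have [|z1 [def_z _]] := @prefix_Psi_last x z c c_neq.
  by apply: prefix_trans pre_zyx; rewrite -cat_rcons prefix_prefix.
have [|_ [_ pre_zya]] := @prefix_Psi_last x (z ++ y') c c_neq.
  by rewrite rcons_cat -def_y.
rewrite rcons_cat -def_y def_z in pre_zya.
rewrite def_z in lps_zy *.
rewrite rev_rcons cat_rcons.
(* The wanted prefix is also the closure of the word prolonged by [a], whose longest palindromic
   suffix starts with [a]. *)
have -> : z1 ++ a :: (c :: y) ++ a :: rev z1
        = z1 ++ (a :: rcons (c :: y) a) ++ rev z1.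
  by rewrite /= cat_rcons.
apply: psi_inf_longest_pal_suffix => //; first exact: longest_pal_suffix_wrap.
rewrite -cat_rcons -rcons_cat -cats1.
have pre_t := prefix_inf_prefix pre_zya (prefix_inf_Psi_letter pre_x).
rewrite -cats1 in pre_t.
by have [x' pre_x' ->] := psi_inf_letter pre_t; exists x'.
Qed.

Lemma factor_inf_Psi_letter s u :
  factor_inf u s -> factor_inf (Psi u ++ [:: a]) (psi_inf s).
Proof.
case/factor_infP=> k /infixP [x [y def_k]].
have pre_xu : prefix_inf (x ++ u) s.
  by apply/prefix_infP; exists k; rewrite def_k catA prefix_prefix.
have := prefix_inf_Psi_letter pre_xu; rewrite word_morphism_cat -catA => pre_t.
apply/factor_infP; exists (size (Psi x ++ Psi u ++ [:: a])).
by rewrite -pre_t infix_catl ?infix_refl.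
Qed.

End Psi.

(** * Episturmian morphisms and powers of the fractionary root *)

Section EpisturmianMorphisms.

Variable A : finType.

Lemma episturmian_morphism_cat (f : seq A -> seq A) :
  episturmian_morphism f -> {morph f : u v / u ++ v}.
Proof.
elim=> [a | a | a b | g h _ IHg _ IHh] u v /=; rewrite ?word_morphism_cat //.
by rewrite IHh IHg.
Qed.

Lemma episturmian_morphism_nseq (f : seq A -> seq A) (a : A) n :
  episturmian_morphism f -> f (nseq n a) = flatten (nseq n (f [:: a])).
Proof.
move=> epi_f; elim: n => [|n IHn] /=.
  (* The image of the empty word equals its own square, so it is empty. *)
  have /(congr1 size)/eqP := episturmian_morphism_cat epi_f [::] [::].
  by rewrite size_cat -{1}[size _]addn0 eqn_add2l eq_sym => /nilP.
by rewrite -IHn -(episturmian_morphism_cat epi_f).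
Qed.

Lemma episturmian_morphism_factors (f : seq A -> seq A) (s : nat -> A) :
  episturmian_morphism f -> standard_episturmian s ->
  exists2 s', standard_episturmian s' &
    forall u, factor_inf u s -> factor_inf (f u) s'.
Proof.
move=> epi_f; elim: epi_f s => [a | a | a b | g h _ IHg _ IHh] s std_s.
- exists (psi_inf a s) => [|u /(factor_inf_Psi_letter a)].
    exact: standard_episturmian_psi.
  by apply: factor_inf_infix; rewrite infix_catr ?infix_refl.
(* Dropping the first letter of the same factor, instead of the last, leaves the image under
   [psibar a]. *)
- exists (psi_inf a s) => [|u /(factor_inf_Psi_letter a)].
    exact: standard_episturmian_psi.
  by apply: factor_inf_infix; rewrite Psi_Psibar -cat1s infix_catl ?infix_refl.
- exists (tperm a b \o s); first exact: (standard_episturmian_map (tpermK a b)).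
  move=> u [i def_u]; exists i.
  have -> : word_morphism (theta a b) u = map (tperm a b) u by exact: flatten_map1.
  by rewrite size_map {1}def_u -map_comp.
have [s1 std1 fac1] := IHh _ std_s; have [s2 std2 fac2] := IHg _ std1.
by exists s2 => // u /fac1 /fac2.
Qed.

(** By periodicity [drop p w] is a prefix of [w], so [w] is a prefix of its root followed by [w],
    and by iteration of any power of the root followed by [w]. For non-empty [w] the root is
    non-empty, so the power [size w] alone is long enough. *)
Lemma prefix_fractionary_root (w : seq A) :
  prefix w (flatten (nseq (size w) (fractionary_root w))).
Proof.
rewrite /fractionary_root /min_period; case: ex_minnP => p.
case/andP=> p_gt0 /forallP per_w _.
have pre_drop : prefix (drop p w) w.
  have [le_wp | /ltnW le_pw] := leqP (size w) p; first by rewrite drop_oversize ?prefix0s.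
  case: w => [|c0 w'] in per_w le_pw *; first by [].
  set w := c0 :: w' in per_w le_pw *.
  rewrite prefixE; apply/eqP/(@eq_from_nth _ c0).
    by rewrite size_take_min size_drop; apply/minn_idPl; rewrite leq_subr.
  move=> i; rewrite size_take_min size_drop => lt_i.
  have {}lt_i : i < size w - p by apply: leq_trans lt_i (geq_minl _ _).
  rewrite nth_take // nth_drop addnC.
  by rewrite -!odflt_onth -(eqP (per_w (Ordinal lt_i))).
have [-> // | w_neq] := eqVneq w [::].
have pre_pow n : prefix w (flatten (nseq n (take p w)) ++ w).
  elim: n => [|n IHn] /=; first exact: prefix_refl.
  have /prefixP [t def_t] := prefix_trans pre_drop IHn.
  by rewrite -catA def_t catA cat_take_drop prefix_prefix.
have /prefixP [t def_t] := pre_pow (size w).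
set v := flatten _ in def_t *.
have le_wv : size w <= size v.
  rewrite /v size_flatten /shape map_nseq sumn_nseq leq_pmull // size_take_min.
  by rewrite leq_min p_gt0 lt0n size_eq0.
by rewrite prefixE -(takel_cat w le_wv) def_t take_size_cat.
Qed.

End EpisturmianMorphisms.

Theorem theorem4p11 (A : finType) (w : seq A) :
  w <> [::] ->
  c_epichristoffel (fractionary_root w) ->
  exists t : nat -> A, episturmian t /\ factor_inf w t.
Proof.
move=> _ [f [a [epi_f def_z]]].
have [s std_s fac_s] :=
  episturmian_morphism_factors epi_f (@standard_episturmian_const _ a).
exists s; split; first by exists s.
have fac_a : factor_inf (nseq (size w) a) (fun=> a).
  exists 0; rewrite size_nseq; elim: (size w) => //= n ->; exact/esym/(mkseqD _ 1).
apply: factor_inf_infix (fac_s _ fac_a).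
rewrite (episturmian_morphism_nseq _ _ epi_f) -def_z.
exact: prefixW (prefix_fractionary_root w).
Qed.
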